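(* Let $G\in\mathcal{G}$, with cliques on $X=\{x_1,\ldots,x_m\}$ and $Y=\{y_1,\ldots,y_n\}$, where $n>m$ and both $n$ and $m$ are odd, such that $N[x_1]=\{y_1,\ldots,y_s\}\cup X$, $N[x_2]=\{y_{s+1},\ldots,y_{s+t}\}\cup X$, and $N[x_i]=X$ for all $3\leq i\leq m$, where $s,t\ge 0$ and $0\leq s+t\leq n-m$. Then $T_2(G)$ is well-covered.
   Context: $\mathcal{G}$ is the class of graphs obtained by taking the disjoint union of a complete graph $K_m$ with vertex set $X=\{x_1,\ldots,x_m\}$ and a complete graph $K_n$ with vertex set $Y=\{y_1,\ldots,y_n\}$, where $n\geq m$, and then adding some (possibly no) edges each joining a vertex of $X$ to a vertex of $Y$. $N[v]$ denotes the closed neighbourhood of $v$ ($v$ together with all its neighbours). The $2$-token graph $T_2(G)$ has as vertices the $2$-subsets of $V(G)$, two of them adjacent if their symmetric difference is an edge of $G$. A graph is well-covered if all of its maximal (with respect to inclusion) independent sets have the same cardinality. *)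

(* Defs.v *)
From HB Require Import structures.
From mathcomp Require Import all_boot.

Set Implicit Arguments.
Unset Strict Implicit.
Unset Printing Implicit Defensive.

Record sgraph := SGraph {
  vertex :> finType;
  adj : rel vertex;
  adj_sym : symmetric adj;
  adj_irr : irreflexive adj }.

Definition closed_nbh (G : sgraph) (v : G) : {set G} :=
  [set u | (u == v) || adj v u].

Definition independent (G : sgraph) (S : {set G}) : bool :=
  [forall u in S, forall v in S, ~~ adj u v].

Definition max_independent (G : sgraph) (S : {set G}) : bool :=
  maxset (@independent G) S.

Definition well_covered (G : sgraph) : Prop :=
  forall S S' : {set G},
    max_independent S -> max_independent S' -> #|S| = #|S'|.

Definition symdiff (T : finType) (A B : {set T}) : {set T} :=
  (A :\: B) :|: (B :\: A).

Section Token2.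
Variable G : sgraph.

Definition token2_vertex : finType := {A : {set G} | #|A| == 2}.

Definition token2_adj : rel token2_vertex := fun A B =>
  [exists u : G, exists v : G,
     adj u v && (symdiff (val A) (val B) == [set u; v])].

Lemma token2_adj_sym : symmetric token2_adj.
Proof.
by move=> A B; rewrite /token2_adj /symdiff setUC.
Qed.

Lemma token2_adj_irr : irreflexive token2_adj.
Proof.
move=> A; apply/negbTE/negP => /existsP[u /existsP[v /andP[_ /eqP]]].
by move/setP/(_ u); rewrite /symdiff setDv setU0 !inE eqxx.
Qed.

Definition token2 : sgraph := SGraph token2_adj_sym token2_adj_irr.

End Token2.

(* Bijectivity encodes that X = {x i} and Y = {y j} partition the vertex set,
   without repetitions; the edges between X and Y are unconstrained. *)
Definition two_cliques (G : sgraph) (m n : nat)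
    (x : 'I_m -> G) (y : 'I_n -> G) : Prop :=
  [/\ m <= n,
      bijective (fun k : 'I_m + 'I_n =>
                   match k with inl i => x i | inr j => y j end),
      forall i i' : 'I_m, i != i' -> adj (x i) (x i')
    & forall j j' : 'I_n, j != j' -> adj (y j) (y j')].

(* Main.v *)
(** An independent set of [T_2(G)] is a set [S] of pairs such that, for every
vertex, its partners in [S] form an independent set of [G].  When [X] and its
complement [Y] are cliques, [S] is therefore the union of a matching inside
[X], a matching inside [Y] and a matching between [X] and [Y].  If [S] is
maximal:
- every [u] in [X] has a partner in [Y]: otherwise at least [n - m + 1 > s + t]
  vertices of [Y] have no partner in [X], whereas at most [s + t] of them are
  blocked for [u], by the neighbours of [u] and of its partner in [X];
- neither inner matching misses three vertices [a, b, c].  A pair [ab] is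
  blocked only if the partner across of one of them is adjacent to the other;
  since each vertex of [Y] has at most one neighbour in [X], blocking all three
  pairs would require three distinct vertices of [X] with neighbours in [Y],
  and only [x_1] and [x_2] have any.
By parity each inner matching misses exactly one vertex, which determines the
size of [S]. *)

Require Import Defs.
From mathcomp Require Import all_boot.
From mathcomp Require Import zify.

Set Implicit Arguments.
Unset Strict Implicit.
Unset Printing Implicit Defensive.

(** * Double counting of families of pairs *)

Lemma sum_pair_eq (T : finType) (A : {set T}) (u : T) :
  #|A| = 2 -> \sum_v ([set u; v] == A : nat) = (u \in A).
Proof.
move=> cA; case: (boolP (u \in A)) => uA; last first.
  rewrite big1 // => v _; case: eqP => // e.
  by move: uA; rewrite -e !inE eqxx.
have := cardsD1 u A; rewrite uA cA => -[/esym/eqP/cards1P[w ew]].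
have uw : u != w by have := set11 w; rewrite -ew !inE eq_sym => /andP[].
rewrite -(setD1K uA) ew (bigD1 w) //= eqxx big1 // => v vw.
case: eqP => // /setP/(_ w); rewrite !inE eqxx orbT.
by rewrite eq_sym (negbTE uw) eq_sym (negbTE vw).
Qed.

(** After exchanging sums, each member of [E] contributes once for each of its two elements. *)
Lemma sum_pairs (T : finType) (E : {set {set T}}) :
    {in E, forall A : {set T}, #|A| = 2} ->
  \sum_u \sum_v ([set u; v] \in E : nat) = 2 * #|E|.
Proof.
move=> card_E.
have memE (B : {set T}) : (B \in E : nat) = \sum_(A in E) (B == A : nat).
  case: (boolP (B \in E)) => BE.
    rewrite (bigD1 B) //= eqxx big1 // => A /andP[_ /negbTE].
    by rewrite eq_sym => ->.
  by rewrite big1 // => A AE; case: eqP => // e; rewrite e AE in BE.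
under eq_bigr => u _ do under eq_bigr => v _ do rewrite memE.
under eq_bigr do rewrite exchange_big.
rewrite exchange_big /= mulnC -sum_nat_const; apply: eq_bigr => A AE.
under eq_bigr do rewrite sum_pair_eq ?card_E //.
by rewrite -(card_E _ AE) -sum1_card [RHS]big_mkcond;
   apply: eq_bigr => u _; case: (u \in A).
Qed.

(** Shows that the sum is even, as the parity argument requires. *)
Lemma sum_pairs_in (T : finType) (E : {set {set T}}) (X : {set T}) :
    {in E, forall A : {set T}, #|A| = 2} ->
  \sum_(u in X) \sum_(v in X) ([set u; v] \in E : nat) =
    2 * #|[set A in E | A \subset X]|.
Proof.
move=> card_E; rewrite -sum_pairs => [|A]; last by rewrite inE => /andP[/card_E].
rewrite big_mkcond; apply: eq_bigr => u _; case: ifP => uX.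
  rewrite big_mkcond; apply: eq_bigr => v _.
  by rewrite inE subUset !sub1set uX; case: (v \in X); rewrite ?andbF ?andbT.
by rewrite big1 // => v _; rewrite inE subUset sub1set uX andbF.
Qed.

(** * Independent sets of the token graph as partner relations *)

Definition pairs (G : sgraph) (S : {set token2 G}) : {set {set G}} :=
  [set val (A : token2_vertex G) | A in S].

(** Turns [S] into a graph on the vertices of [G]: linked vertices are partners. *)
Definition link (G : sgraph) (S : {set token2 G}) : rel G :=
  fun u v => [set u; v] \in pairs S.

Lemma card_pairs (G : sgraph) (S : {set token2 G}) : #|pairs S| = #|S|.
Proof. by rewrite card_imset //; apply: val_inj. Qed.

Lemma card_in_pairs (G : sgraph) (S : {set token2 G}) :
  {in pairs S, forall A : {set G}, #|A| = 2}.
Proof. by move=> _ /imsetP[A _ ->]; apply/eqP/(valP A). Qed.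

Lemma link_sym (G : sgraph) (S : {set token2 G}) : symmetric (link S).
Proof. by move=> u v; rewrite /link setUC. Qed.

Lemma link_neq (G : sgraph) (S : {set token2 G}) u v : link S u v -> u != v.
Proof. by move/card_in_pairs; rewrite cards2; case: eqP. Qed.

Lemma adj_neq (G : sgraph) (u v : G) : adj u v -> u != v.
Proof. by apply: contraTneq => ->; rewrite adj_irr. Qed.

Lemma token2_adj_of (G : sgraph) (A B : token2_vertex G) (a b c : G) :
    val A = [set a; b] -> val B = [set a; c] -> a != b -> a != c -> adj b c ->
  token2_adj A B.
Proof.
move=> eA eB ab ac bc; apply/existsP; exists b; apply/existsP; exists c.
have nbc := adj_neq bc.
rewrite bc eA eB /=; apply/eqP/setP => z; rewrite !inE.
case: (z =P a) => [->|_] /=; first by rewrite (negbTE ab) (negbTE ac).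
by case: (z =P b) => [->|_] //=; rewrite ?(negbTE nbc) ?andbF.
Qed.

(** The two differences have equal size and together two elements, so [A] and [B] share exactly
    one. *)
Lemma symdiff_pairs (T : finType) (A B : {set T}) (u v : T) :
    #|A| = 2 -> #|B| = 2 -> u != v -> symdiff A B = [set u; v] ->
  exists a b c, [/\ A = [set a; b], B = [set a; c] & [set b; c] = [set u; v]].
Proof.
move=> cA cB uv e.
have hA := cardsID B A; have hB := cardsID A B; have h := cards2 u v.
have dis : (A :\: B) :&: (B :\: A) = set0.
  by apply/setP => z; rewrite !inE; case: (z \in A); case: (z \in B).
rewrite -e /symdiff cardsU dis cards0 uv subn0 in h; rewrite setIC in hB.
have /eqP/cards1P[a ea] : #|A :&: B| = 1 by lia.
have /eqP/cards1P[b eb] : #|A :\: B| = 1 by lia.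
have /eqP/cards1P[c ec] : #|B :\: A| = 1 by lia.
exists a, b, c; rewrite -e /symdiff -ea -eb -ec; split=> //.
  by rewrite setID.
by rewrite setIC setID.
Qed.

Lemma token2_adjE (G : sgraph) (A B : token2_vertex G) :
  token2_adj A B ->
  exists a b c, [/\ val A = [set a; b], val B = [set a; c] & adj b c].
Proof.
move=> /existsP[u /existsP[v /andP[uv /eqP e]]].
have cA := eqP (valP A); have cB := eqP (valP B).
have [a [b [c [eA eB ebc]]]] := symdiff_pairs cA cB (adj_neq uv) e.
exists a, b, c; split=> //.
have := set21 u v; have := set22 u v; rewrite -ebc !inE.
have := adj_neq uv.
by move=> nuv /orP[]/eqP ev /orP[]/eqP eu; move: uv nuv;
  rewrite eu ev ?eqxx // adj_sym.
Qed.

Lemma independent_link (G : sgraph) (S : {set token2 G}) (u v w : G) :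
  independent S -> link S u v -> link S u w -> ~~ adj v w.
Proof.
move=> iS uv uw; apply/negP => vw.
have nuv := link_neq uv; have nuw := link_neq uw.
move: uv uw => /imsetP[A AS eA] /imsetP[B BS eB].
move: iS => /forallP/(_ A); rewrite AS => /forallP/(_ B); rewrite BS /=.
by rewrite (@token2_adj_of G A B u v w).
Qed.

(** A member of [S] in conflict with {u, v} contains one of u, v together with a partner adjacent to
    the other. Both cases are excluded, so {u, v} can be added to [S] and by maximality is already
    there. *)
Lemma max_independent_link (G : sgraph) (S : {set token2 G}) (u v : G) :
    max_independent S -> u != v ->
    (forall w, link S u w -> ~~ adj w v) ->
    (forall w, link S v w -> ~~ adj w u) ->
  link S u v.
Proof.
move=> /maxsetP[iS maxS] nuv hu hv.
have cA : #|[set u; v]| == 2 by rewrite cards2 nuv.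
pose A : token2_vertex G := exist _ [set u; v] cA.
have nA (B : token2_vertex G) : B \in S -> ~~ token2_adj A B.
  move=> BS; apply/negP => /token2_adjE[a [b [c [eA eB bc]]]].
  have lac : link S a c by apply/imsetP; exists B.
  have : a \in val A by rewrite eA set21.
  have : b \in val A by rewrite eA set22.
  have nab : a != b.
    by apply/eqP => ab; have := eqP (valP A); rewrite eA ab setUid cards1.
  rewrite !inE => /orP[]/eqP eb /orP[]/eqP ea; subst a b; rewrite ?eqxx // in nab.
    by have := hv _ lac; rewrite adj_sym bc.
  by have := hu _ lac; rewrite adj_sym bc.
have iSA : independent (A |: S : {set token2 G}).
  apply/forallP => B; apply/implyP => BS; apply/forallP => C; apply/implyP => CS.
  move: BS CS; rewrite !inE => /orP[/eqP->|BS] /orP[/eqP->|CS].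
  - by rewrite adj_irr.
  - exact: nA.
  - by rewrite adj_sym; apply: nA.
  - by move: iS => /forallP/(_ B); rewrite BS => /forallP/(_ C); rewrite CS.
apply/imsetP; exists A => //.
by rewrite -(maxS _ iSA) ?setU11 // subsetUr.
Qed.

(** With out-degree at most one, [a] cannot send arcs to both [b] and [c], so it receives one. *)
Lemma out_unique_target (T : eqType) (r : rel T) (a b c : T) :
    (forall u v w, r u v -> r u w -> v = w) -> b != c ->
    r a b || r b a -> r a c || r c a ->
  r b a || r c a.
Proof.
move=> uniq_r nbc; case: (r b a) => //; case: (r c a); rewrite ?orbT ?orbF //.
by move=> ab ac; rewrite (uniq_r _ _ _ ab ac) eqxx in nbc.
Qed.

(** * Maximal independent sets over two sparsely joined cliques *)

Section TwoCliques.

(** [p] and [q] stand for x_1 and x_2, and may coincide. *)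
Variables (G : sgraph) (X : {set G}) (p q : G).

Hypothesis X_clique : {in X &, forall u v : G, u != v -> adj u v}.
Hypothesis Y_clique : {in ~: X &, forall u v : G, u != v -> adj u v}.
Hypothesis X_gates :
  {in X & ~: X, forall u v : G, adj u v -> (u == p) || (u == q)}.
Hypothesis Y_nbr :
  {in X & X, forall u u' : G, {in ~: X, forall v, adj u v -> adj u' v -> u = u'}}.

Let K := [set v in ~: X | [exists u in X, adj u v]].

Hypothesis card_K : #|K| <= #|~: X| - #|X|.
Hypothesis card_X : #|X| < #|~: X|.
Hypothesis odd_X : odd #|X|.
Hypothesis odd_Y : odd #|~: X|.

Variable S : {set token2 G}.
Hypothesis maxS : max_independent S.

Local Notation h := (link S).

Let indS : independent S.
Proof. by case/maxsetP: maxS. Qed.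

(** The partners of [u] are pairwise non-adjacent, so a clique contains at most one of them. *)
Lemma clique_link_unique (C : {set G}) (u v w : G) :
    {in C &, forall u v : G, u != v -> adj u v} ->
  v \in C -> w \in C -> h u v -> h u w -> v = w.
Proof.
move=> clC vC wC uv uw; apply/eqP/negPn/negP => nvw.
by have := independent_link indS uv uw; rewrite clC.
Qed.

Lemma sum_link_clique (C : {set G}) (u : G) :
    {in C &, forall u v : G, u != v -> adj u v} ->
  \sum_(v in C) (h u v : nat) = [exists v in C, h u v].
Proof.
move=> clC; case: (boolP [exists v in C, h u v]) => [/existsP[v /andP[vC uv]]|].
  rewrite (bigD1 v) //= uv big1 // => w /andP[wC nwv].
  apply/eqP; rewrite eqb0; apply: contra nwv => uw; apply/eqP.
  exact: (clique_link_unique clC wC vC uw uv).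
rewrite negb_exists => /forallP H; rewrite big1 // => w wC.
by have := H w; rewrite wC /= => /negbTE ->.
Qed.

Lemma blocked_pair (u v : G) :
    u != v -> ~~ h u v ->
  (exists2 w, h u w & adj w v) \/ (exists2 w, h v w & adj w u).
Proof.
move=> nuv nh.
case: (boolP [exists w, h u w && adj w v]) => [/existsP[w /andP[]]|/existsPn Hu].
  by left; exists w.
case: (boolP [exists w, h v w && adj w u]) => [/existsP[w /andP[]]|/existsPn Hv].
  by right; exists w.
case/negP: nh; apply: (max_independent_link maxS) => // w Hw; apply/negP => a.
  by have := Hu w; rewrite Hw a.
by have := Hv w; rewrite Hw a.
Qed.

Let unmatched (C : {set G}) := [set u in C | ~~ [exists v in C, h u v]].

Lemma unmatchedP (C : {set G}) u :
  u \in unmatched C -> u \in C /\ (forall v, h u v -> v \in ~: C).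
Proof.
rewrite inE => /andP[uC /existsPn H]; split=> // v uv; rewrite inE.
by apply/negP => vC; have := H v; rewrite vC uv.
Qed.

(** The sum is even, and it is |C| minus the number of unmatched vertices. As |C| is odd, that
    number is odd, hence 1. *)
Lemma sum_link_inside (C : {set G}) :
    {in C &, forall u v : G, u != v -> adj u v} ->
    odd #|C| -> #|unmatched C| <= 2 ->
  \sum_(u in C) \sum_(v in C) (h u v : nat) = #|C|.-1.
Proof.
move=> clC odd_C le2.
have even := sum_pairs_in C (@card_in_pairs G S).
have eqs : \sum_(u in C) \sum_(v in C) (h u v : nat) + #|unmatched C| = #|C|.
  under eq_bigr do rewrite sum_link_clique //.
  rewrite -!sum1_card [X in _ + X = _]big_mkcond [X in X + _]big_mkcond.
  rewrite -big_split [RHS]big_mkcond; apply: eq_bigr => u _ /=; rewrite inE.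
  by case: (u \in C); case: [exists v in C, _].
rewrite /link in eqs *; lia.
Qed.

(* [arc C a b]: the partner of [a] outside [C] forbids adding the pair [ab]. *)
Let arc (C : {set G}) : rel G :=
  fun a b => [exists w in ~: C, h a w && adj w b].

(** Partners of an unmatched vertex lie outside [C], so the partner blocking the pair witnesses an
    arc. *)
Lemma blocked_arc (C : {set G}) (a b : G) :
    a \in unmatched C -> b \in unmatched C -> a != b -> arc C a b || arc C b a.
Proof.
move=> /unmatchedP[aC Ha] /unmatchedP[bC Hb] ab.
have nh : ~~ h a b by apply/negP => /Ha; rewrite inE bC.
case: (blocked_pair ab nh) => -[w hw aw]; apply/orP; [left|right];
  apply/existsP; exists w; rewrite hw aw !andbT; by [apply: Ha|apply: Hb].
Qed.

Lemma three_gates (a b c : G) :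
    [|| a == p | a == q] -> [|| b == p | b == q] -> [|| c == p | c == q] ->
  [|| a == b, b == c | c == a].
Proof.
by do 3![case/orP=> /eqP->]; rewrite ?eqxx ?orbT.
Qed.

(** An arc's source has one partner in Y, which has at most one neighbour in [X]: arcs are
    out-unique. So each of three unmatched vertices would be the target of an arc, hence adjacent to
    Y, hence [p] or [q]. *)
Lemma card_unmatched_X : #|unmatched X| <= 2.
Proof.
rewrite leqNgt; apply/negP => /card_gt2P[a [b [c [[aU bU cU] [ab bc ca]]]]].
have arcU u v w : arc X u v -> arc X u w -> v \in X -> w \in X -> v = w.
  move=> /existsP[z /and3P[zY uz zv]] /existsP[z' /and3P[zY' uz' zw]] vX wX.
  have e := clique_link_unique Y_clique zY zY' uz uz'; subst z'.
  by apply: (Y_nbr vX wX zY); rewrite adj_sym.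
(* Targets must be restricted to [X], since a partner in Y may be adjacent to many vertices of Y. *)
pose r := [rel u v : G | [&& arc X u v, u \in X & v \in X]].
have rU u v w : r u v -> r u w -> v = w.
  by move=> /and3P[uv _ vX] /and3P[uw _ wX]; apply: arcU uv uw vX wX.
have [aX _] := unmatchedP aU; have [bX _] := unmatchedP bU.
have [cX _] := unmatchedP cU.
have rb u v : u \in unmatched X -> v \in unmatched X -> u != v -> r u v || r v u.
  move=> uU vU uv; have [uX _] := unmatchedP uU; have [vX _] := unmatchedP vU.
  by rewrite /= uX vX !andbT; apply: blocked_arc.
have gate u v : r u v -> (v == p) || (v == q).
  move=> /and3P[/existsP[w /and3P[wY _ wv]] _ vX].
  by apply: (X_gates vX wY); rewrite adj_sym.
have target u v w : u \in unmatched X -> v \in unmatched X ->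
    w \in unmatched X -> u != v -> v != w -> w != u -> (u == p) || (u == q).
  move=> uU vU wU uv vw wu; rewrite eq_sym in wu.
  have := out_unique_target rU vw (rb u v uU vU uv) (rb u w uU wU wu).
  by case/orP; apply: gate.
have ga := target a b c aU bU cU ab bc ca.
have gb := target b c a bU cU aU bc ca ab.
have gc := target c a b cU aU bU ca ab bc.
have := three_gates ga gb gc.
by rewrite (negbTE ab) (negbTE bc) (negbTE ca).
Qed.

(** Each of three unmatched vertices would be the source of an arc, so have [p] or [q] as a partner;
    two of them would then share a partner, which the clique Y forbids. *)
Lemma card_unmatched_Y : #|unmatched (~: X)| <= 2.
Proof.
rewrite leqNgt; apply/negP => /card_gt2P[a [b [c [[aU bU cU] [ab bc ca]]]]].
(* Inside [Y] it is the reversed arc relation that is out-unique. *)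
pose r := [rel v u : G | [&& arc (~: X) u v, u \in ~: X & v \in ~: X]].
have rU v u w : r v u -> r v w -> u = w.
  move=> /and3P[/existsP[z /and3P[zX uz zv]] uY vY].
  move=> /and3P[/existsP[z' /and3P[zX' uz' zv']] wY _].
  rewrite setCK in zX zX'.
  have e := Y_nbr zX zX' vY zv zv'; subst z'.
  by apply: (clique_link_unique Y_clique uY wY); rewrite link_sym; eassumption.
have rb u v : u \in unmatched (~: X) -> v \in unmatched (~: X) -> u != v ->
    r u v || r v u.
  move=> uU vU uv; have [uX _] := unmatchedP uU; have [vX _] := unmatchedP vU.
  by rewrite /= uX vX !andbT orbC; apply: blocked_arc.
have gate v u : r v u -> exists2 w, h u w & (w == p) || (w == q).
  move=> /and3P[/existsP[w /and3P[wX uw wv]] _ vY]; rewrite setCK in wX.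
  by exists w => //; apply: (X_gates wX vY).
have target u v w : u \in unmatched (~: X) -> v \in unmatched (~: X) ->
    w \in unmatched (~: X) -> u != v -> v != w -> w != u ->
    exists2 z, h u z & (z == p) || (z == q).
  move=> uU vU wU uv vw wu; rewrite eq_sym in wu.
  have := out_unique_target rU vw (rb u v uU vU uv) (rb u w uU wU wu).
  by case/orP; apply: gate.
have [a' ha ga] := target a b c aU bU cU ab bc ca.
have [b' hb gb] := target b c a bU cU aU bc ca ab.
have [c' hc gc] := target c a b cU aU bU ca ab bc.
have [aY _] := unmatchedP aU; have [bY _] := unmatchedP bU.
have [cY _] := unmatchedP cU.
have neq u v w : u \in ~: X -> v \in ~: X -> u != v -> h u w -> ~ h v w.
  move=> uY vY /eqP uv uw vw; apply: uv.
  by apply: (clique_link_unique Y_clique uY vY); rewrite link_sym; eassumption.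
case/or3P: (three_gates ga gb gc) => /eqP e; subst.
- exact: neq aY bY ab ha hb.
- exact: neq bY cY bc hb hc.
- exact: neq cY aY ca hc ha.
Qed.

(** Choosing a partner in [A] for each member of [B] is injective, because no vertex has two
    partners in the clique Y. *)
Lemma leq_card_linked (A B : {set G}) :
    {subset B <= ~: X} -> {in B, forall v, exists2 w, w \in A & h w v} ->
  #|B| <= #|A|.
Proof.
move=> BY linked.
pose f v := odflt v [pick w in A | h w v].
have fP v : v \in B -> f v \in A /\ h (f v) v.
  move=> /linked[w wA wv]; rewrite /f.
  by case: pickP => [z /andP[]//|/(_ w)]; rewrite wA wv.
have fI : {in B &, injective f}.
  move=> v w vB wB e; have [_ hv] := fP _ vB; have [_ hw] := fP _ wB.
  rewrite -e in hw.
  exact: (clique_link_unique Y_clique (BY _ vB) (BY _ wB) hv hw).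
rewrite -(card_in_imset fI); apply: subset_leq_card.
by apply/subsetP => _ /imsetP[v vB ->]; have [] := fP _ vB.
Qed.

(** If [u] had no partner in Y, every v in Y would have a partner in [X] ([M]), have a partner in Y
    adjacent to [u] ([Bu]), or be adjacent to a partner of [u] ([Nb]); otherwise [u] and v would be
    linked. These sets are too small to cover Y. *)
Lemma sum_link_XY : {in X, forall u, \sum_(v in ~: X) (h u v : nat) = 1}.
Proof.
suff HX u : u \in X -> [exists v in ~: X, h u v].
  by move=> u uX; rewrite sum_link_clique // HX.
move=> uX; apply: contraT => nu.
have {nu} noY v : h u v -> v \in X.
  move=> uv; apply: contraT => vX; case/negP: nu.
  by apply/existsP; exists v; rewrite inE vX.
pose M := [set v in ~: X | [exists w in X, h w v]].
have card_M : #|M| < #|X|.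
  (* All partners of [u] lie in [X], so [u] serves no member of [M]; hence the strict bound. *)
  rewrite (cardsD1 u X) uX ltnS; apply: leq_card_linked => v.
    by rewrite inE => /andP[].
  rewrite inE => /andP[vY /existsP[w /andP[wX wv]]]; exists w => //.
  rewrite !inE wX andbT; apply/eqP => e; rewrite e in wv.
  by move: vY; rewrite inE (noY _ wv).
pose Nu := [set v in ~: X | adj u v].
pose Nb := [set v in ~: X | [exists w in X, h u w && adj w v]].
pose Bu := [set v in ~: X | [exists w in Nu, h v w]].
have card_Bu : #|Bu| <= #|Nu|.
  apply: leq_card_linked => v; rewrite inE => /andP[] // _ /existsP[w /andP[wN vw]].
  by exists w; rewrite // link_sym.
have card_NN : #|Nu| + #|Nb| <= #|K|.
  (* [u] and a partner of it in [X] are distinct, so they have no common neighbour in Y. *)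
  have dis : Nu :&: Nb = set0.
    apply/setP => v; rewrite !inE; apply/negP.
    move=> /andP[/andP[vX uv] /andP[_ /existsP[w /and3P[wX uw wv]]]].
    have vY : v \in ~: X by rewrite inE.
    by have := link_neq uw; rewrite (Y_nbr uX wX vY uv wv) eqxx.
  rewrite -cardsUI dis cards0 addn0; apply: subset_leq_card.
  apply/subsetP => v; rewrite !inE => /orP[]/andP[-> /=].
    by move=> uv; apply/existsP; exists u; rewrite uX.
  by case/existsP=> w /and3P[wX _ wv]; apply/existsP; exists w; rewrite wX.
(* The total is at most (|X| - 1) + |K|, which is at most |Y| - 1. *)
have : #|M :|: Bu :|: Nb| < #|~: X|.
  have := (leq_card_setU (M :|: Bu) Nb).1; have := (leq_card_setU M Bu).1.
  move: card_M card_Bu card_NN card_K card_X; lia.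
rewrite ltnNge => /negP[]; apply: subset_leq_card; apply/subsetP => v vY.
apply/negPn/negP; rewrite !inE -in_setC vY /=.
move=> /norP[/norP[nM nB] nN].
have nuv : u != v by apply: contraTneq vY => <-; rewrite inE uX.
have huv : h u v.
  apply: (max_independent_link maxS nuv) => w hw; apply/negP => a.
    by case/negP: nN; apply/existsP; exists w; rewrite hw a noY.
  case: (boolP (w \in X)) => wX.
    by case/negP: nM; apply/existsP; exists w; rewrite wX link_sym.
  by case/negP: nB; apply/existsP; exists w; rewrite !inE wX hw adj_sym a.
by have := noY _ huv; move: vY; rewrite inE => /negbTE->.
Qed.

(** Ordered linked pairs are counted by blocks: |X| - 1 inside [X], |Y| - 1 inside Y, and |X| in
    each of the two mixed blocks. *)
Lemma card_max_independent : 2 * #|S| = 3 * #|X| + #|~: X| - 2.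
Proof.
rewrite -card_pairs -(sum_pairs (@card_in_pairs G S)).
have splitX F : \sum_(u : G) F u = \sum_(u in X) F u + \sum_(u in ~: X) F u.
  by rewrite (bigID (mem X)) /=; congr (_ + _); apply: eq_bigl => u; rewrite inE.
rewrite splitX.
under eq_bigr do rewrite splitX.
rewrite big_split; under [X in _ + X]eq_bigr do rewrite splitX.
rewrite big_split /= (sum_link_inside X_clique odd_X card_unmatched_X).
rewrite (sum_link_inside Y_clique odd_Y card_unmatched_Y).
rewrite [X in _ + (X + _)]exchange_big /=.
under [X in _ + (X + _)]eq_bigr do under eq_bigr do rewrite setUC.
have -> : \sum_(u in X) \sum_(v in ~: X) ([set u; v] \in pairs S : nat) = #|X|.
  by rewrite (eq_bigr _ sum_link_XY) sum1_card.
move: odd_X odd_Y; lia.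
Qed.

End TwoCliques.

(** * Application to the indexed cliques *)

Lemma leq_card_ord_lt (n k : nat) : #|[set j : 'I_n | j < k]| <= k.
Proof.
rewrite cardE -(size_map val) -{2}(size_iota 0 k); apply: uniq_leq_size.
  by rewrite map_inj_uniq ?enum_uniq //; apply: val_inj.
by move=> _ /mapP[j + ->]; rewrite mem_enum inE mem_iota.
Qed.

Unset Implicit Arguments.

Theorem theorem6p10 (G : sgraph) (m n s t : nat)
    (x : 'I_m -> G) (y : 'I_n -> G)
    (hG : two_cliques x y)
    (hmn : m < n) (hm : odd m) (hn : odd n)
    (hst : s + t <= n - m)
    (hx1 : forall i : 'I_m, i = 0 :> nat ->
       closed_nbh (x i) =
         [set y j | j : 'I_n & j < s] :|: [set x k | k : 'I_m])
    (hx2 : forall i : 'I_m, i = 1 :> nat ->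
       closed_nbh (x i) =
         [set y j | j : 'I_n & s <= j < s + t] :|: [set x k | k : 'I_m])
    (hx3 : forall i : 'I_m, 2 <= i ->
       closed_nbh (x i) = [set x k | k : 'I_m]) :
  well_covered (token2 G).
Proof.
case: hG => _ [g gK Kg] xcl ycl.
have xI : injective x.
  by move=> i j e; have [] := can_inj gK (x1 := inl i) (x2 := inl j) e.
have yI : injective y.
  by move=> i j e; have [] := can_inj gK (x1 := inr i) (x2 := inr j) e.
pose X := [set x k | k : 'I_m].
have yX j : y j \notin X.
  by apply/imsetP => -[i _ e]; have := can_inj gK (x1 := inr j) (x2 := inl i) e.
have eY : ~: X = [set y j | j : 'I_n].
  apply/setP => v; rewrite inE; apply/idP/imsetP => [vX|[j _ ->] //].
  have := Kg v; case: (g v) => [i|j] e; last by exists j.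
  by case/imsetP: vX; exists i.
have cX : #|X| = m by rewrite card_imset // card_ord.
have cY : #|~: X| = n by rewrite eY card_imset // card_ord.
(* Indices start at 0, so x_1 and x_2 have indices 0 and 1. *)
have adjxy i j : adj (x i) (y j) ->
    (i == 0 :> nat) && (j < s) || (i == 1 :> nat) && (s <= j < s + t).
  move=> a; have : y j \in closed_nbh (x i) by rewrite inE a orbT.
  case: (ltngtP i 1) => i1.
  - rewrite hx1; last by lia.
    rewrite inE (negbTE (yX j)) orbF => /imsetP[j' + /yI ->]; rewrite inE => ->.
    by have -> : (i : nat) = 0 by lia.
  - by rewrite hx3 // (negbTE (yX j)).
  - rewrite hx2 // inE (negbTE (yX j)) orbF => /imsetP[j' + /yI ->].
    by rewrite inE i1 => ->.
have m0 : 0 < m by case: (m) hm.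
pose p := x (Ordinal m0).
(* For m = 1 there is no x_2, and [p] is used as a dummy value. *)
have [q qP] : exists q, forall i : 'I_m, i = 1 :> nat -> x i = q.
  case: (ltnP 1 m) => m1; last by exists p => i i1; have := ltn_ord i; lia.
  by exists (x (Ordinal m1)) => i i1; congr x; apply: val_inj.
have card_S (S : {set token2 G}) : max_independent S -> 2 * #|S| = 3 * m + n - 2.
  rewrite -cX -cY; apply: (@card_max_independent G X p q); rewrite ?cX ?cY //.
  - move=> _ _ /imsetP[i _ ->] /imsetP[j _ ->] ij.
    by apply: xcl; apply: contra_neq ij => ->.
  - rewrite eY => _ _ /imsetP[i _ ->] /imsetP[j _ ->] ij.
    by apply: ycl; apply: contra_neq ij => ->.
  - rewrite eY => _ _ /imsetP[i _ ->] /imsetP[j _ ->] /adjxy.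
    case/orP=> /andP[/eqP i1 _]; last by rewrite (qP i i1) eqxx orbT.
    by have -> : i = Ordinal m0 by [apply: val_inj]; rewrite eqxx.
  (* The ranges j < s and s <= j < s + t are disjoint, so [j] determines the neighbour's index. *)
  - rewrite eY => _ _ /imsetP[i _ ->] /imsetP[i' _ ->] _ /imsetP[j _ ->].
    by move=> /adjxy ij /adjxy ij'; congr x; apply: val_inj => /=; lia.
  (* The vertices of Y with a neighbour in [X] are among the first s + t. *)
  - apply: leq_trans hst.
    apply: leq_trans (leq_card_ord_lt n (s + t)); rewrite -(card_imset _ yI).
    apply: subset_leq_card; apply/subsetP => v; rewrite inE eY.
    case/andP=> /imsetP[j _ ->] /existsP[_ /andP[/imsetP[i _ ->] /adjxy ij]].
    by apply/imsetP; exists j => //; rewrite inE; lia.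
by move=> S S' /card_S e /card_S; lia.
Qed.
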